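(* Let $G$ be a graph on $n$ vertices and let $\overline{G}$ be its complement. Then $\operatorname{ppt}(G)+\operatorname{ppt}(\overline{G})\leq n+2$.
   Context: All graphs are finite and simple, and are not assumed to be connected. For a graph $G$ and $S\subseteq V(G)$, let $N(v)$ be the set of neighbors of $v$ and $N[S]=S\cup\bigcup_{s\in S}N(s)$. Define $S^{[0]}=S$, $S^{[1]}=N[S]$, and for $t\geq 1$, $S^{[t+1]}=S^{[t]}\cup\{w\in V(G) : \exists\, v\in S^{[t]},\ N(v)\setminus S^{[t]}=\{w\}\}$. The set $S$ is a power dominating set of $G$ if $S^{[\ell]}=V(G)$ for some $\ell$; the power domination number $\gamma_P(G)$ is the minimum cardinality of a power dominating set, and a power dominating set of that cardinality is called minimum. For a power dominating set $S$, $\operatorname{ppt}(G,S)$ is the smallest $\ell\ge 0$ with $S^{[\ell]}=V(G)$. The power propagation time of $G$ is $\operatorname{ppt}(G)=\min\{\operatorname{ppt}(G,S) : S \text{ is a minimum power dominating set of } G\}$. *)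

(* Defs.v *)
From mathcomp Require Import all_boot.

Set Implicit Arguments.
Unset Strict Implicit.
Unset Printing Implicit Defensive.

Record sgraph := SGraph {
  vertex :> finType;
  adj : rel vertex;
  adj_sym : symmetric adj;
  adj_irr : irreflexive adj }.

Section Complement.
Variable G : sgraph.

Definition compl_adj : rel G := fun x y => (x != y) && ~~ adj x y.

Lemma compl_adj_sym : symmetric compl_adj.
Proof. by move=> x y; rewrite /compl_adj [y == x]eq_sym adj_sym. Qed.

Lemma compl_adj_irr : irreflexive compl_adj.
Proof. by move=> x; rewrite /compl_adj eqxx. Qed.

Definition compl : sgraph := SGraph compl_adj_sym compl_adj_irr.

End Complement.

Section PowerDomination.
Variable G : sgraph.
Implicit Types (S : {set G}) (v w : G).

Definition nbh v : {set G} := [set w | adj v w].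

Definition cl_nbh S : {set G} := S :|: \bigcup_(s in S) nbh s.

Definition force_step S : {set G} :=
  S :|: [set w | [exists v in S, nbh v :\: S == [set w]]].

(* S^[0] = S, S^[1] = N[S], and S^[t+1] = force_step S^[t] for t >= 1. *)
Definition pd_iter S (t : nat) : {set G} :=
  if t is t'.+1 then iter t' force_step (cl_nbh S) else S.

(* The bound on l makes the predicate decidable without restricting it: see
   power_dominatingP. *)
Definition power_dominating S : bool :=
  [exists l : 'I_#|G|.+1, pd_iter S l == [set: G]].

Lemma pd_iter_sub S t : pd_iter S t \subset pd_iter S t.+1.
Proof. by case: t => [|t]; apply: subsetUl. Qed.

Lemma pd_iter_stable S t :
  pd_iter S t.+1 = pd_iter S t -> pd_iter S t.+2 = pd_iter S t.+1.
Proof.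
case: t => [|t] /=; last by move=> Ft; rewrite !Ft.
move=> NS; rewrite NS /force_step; apply/setUidPl/subsetP => w; rewrite inE.
case/exists_inP => v vS /eqP /setP /(_ w); rewrite !inE eqxx => /andP[wS avw].
by rewrite -NS inE; apply/orP; right; apply/bigcupP; exists v; rewrite ?inE.
Qed.

Lemma pd_iter_bound S l : pd_iter S l = [set: G] ->
  (forall k, pd_iter S k = [set: G] -> l <= k) -> l <= #|G|.
Proof.
move=> Sl minl.
have stab k j : pd_iter S k.+1 = pd_iter S k ->
    pd_iter S (j + k) = pd_iter S k /\ pd_iter S (j + k).+1 = pd_iter S k.
  move=> Sk; elim: j => [|j [IH1 IH2]]; first by [].
  by split=> //; rewrite addSn (pd_iter_stable (t := j + k)) IH2.
suff card_ge k : k <= l -> k <= #|pd_iter S k|.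
  by apply: leq_trans (card_ge l (leqnn l)) (max_card _).
elim: k => // k IH lt_kl; apply: leq_ltn_trans (IH (ltnW lt_kl)) _.
rewrite proper_card // properEneq pd_iter_sub andbT; apply/eqP => /esym Sk.
have [Slk _] := stab k (l - k) Sk; move: Slk.
by rewrite subnK 1?ltnW // Sl => /esym /minl; rewrite leqNgt lt_kl.
Qed.

Lemma power_dominatingP S :
  reflect (exists l, pd_iter S l = [set: G]) (power_dominating S).
Proof.
apply: (iffP existsP) => [[l /eqP Sl]|[l0 Sl0]]; first by exists l.
have exl : exists l, pd_iter S l == [set: G] by exists l0; apply/eqP.
case: (ex_minnP exl) => l /eqP Sl minl.
have lt_l : l < #|G|.+1.
  by rewrite ltnS; apply: (pd_iter_bound Sl) => k Sk; apply: minl; apply/eqP.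
by exists (Ordinal lt_l); apply/eqP.
Qed.

Lemma power_dominatingT : power_dominating [set: G].
Proof. by apply/power_dominatingP; exists 0. Qed.

Definition min_pds0 : {set G} :=
  [arg min_(S < [set: G] | power_dominating S) #|S|].

Definition pd_number : nat := #|min_pds0|.

Definition min_power_dominating S : bool :=
  power_dominating S && (#|S| == pd_number).

(* Least l with pd_iter S l = V(G); ppt_setP is the specification.  The value
   is meaningless when S is not power dominating. *)
Definition ppt_set S : nat :=
  find (fun l => pd_iter S l == [set: G]) (iota 0 #|G|.+1).

(* min_pds0 only seeds the minimisation: pptP shows that ppt is the minimum of
   ppt_set over all minimum power dominating sets. *)
Definition ppt : nat :=
  ppt_set [arg min_(S < min_pds0 | min_power_dominating S) ppt_set S].

Lemma ppt_setP S : power_dominating S ->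
  pd_iter S (ppt_set S) = [set: G] /\
  forall l, pd_iter S l = [set: G] -> ppt_set S <= l.
Proof.
case/existsP => l0 Sl0; rewrite /ppt_set.
set p := fun l => _; set r := iota _ _.
have hp : has p r.
  by apply/hasP; exists (val l0) => //; rewrite mem_iota /= add0n ltn_ord.
have lt_f : find p r < #|G|.+1 by move: hp; rewrite has_find size_iota.
split=> [|l Sl]; first by have := nth_find 0 hp; rewrite nth_iota // => /eqP.
rewrite leqNgt; apply/negP => lt_l; have := before_find 0 lt_l.
by rewrite nth_iota ?(ltn_trans lt_l) // add0n /p Sl eqxx.
Qed.

Lemma pd_numberP :
  (exists2 S, power_dominating S & #|S| = pd_number) /\
  forall S, power_dominating S -> pd_number <= #|S|.
Proof.
rewrite /pd_number /min_pds0; case: arg_minnP => [|S pdS minS].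
  exact: power_dominatingT.
by split; first exists S.
Qed.

Lemma min_pds0P : min_power_dominating min_pds0.
Proof.
rewrite /min_power_dominating eqxx andbT /min_pds0.
by case: arg_minnP => //; apply: power_dominatingT.
Qed.

Lemma pptP :
  (exists2 S, min_power_dominating S & ppt_set S = ppt) /\
  forall S, min_power_dominating S -> ppt <= ppt_set S.
Proof.
rewrite /ppt; case: arg_minnP => [|S mS minS]; first exact: min_pds0P.
by split; first exists S.
Qed.

End PowerDomination.

(* Main.v *)
Require Import Defs.
From mathcomp Require Import all_boot.
From mathcomp Require Import zify.

(** Power domination turns a graph into an interval model.  Run the process from
    a power dominating set [S] that needs [l] steps, let [b x] be the time at
    which [x] is observed and let [d x] be the time at which the whole closed
    neighborhood of [x] is observed.  Adjacent vertices get intersecting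
    intervals [[b x, d x]].  Each time [t] with [1 <= t <= l] is a left end,
    because step [t] observes something new, and also a right end, because the
    vertex responsible for a new observation has nothing left to observe.  So
    a point [p] misses at least [l - 1] intervals: each later time is the left
    end of a missed interval and each earlier time is the right end of one
    ([leq_card_missed]).

    Do this for [G] and for its complement, with [l] and [m] steps.  Two distinct
    vertices are adjacent in one of the graphs, so their intervals meet in at
    least one of the two models.  For such a pair of models there are points
    [p] and [q], one for each model, such that every vertex has its first
    interval through [p] or its second through [q] ([cross_stabbing]).  Hence the
    sets of vertices missed by [p] and by [q] are disjoint, and
    [(l - 1) + (m - 1) <= n]. *)

Set Implicit Arguments.
Unset Strict Implicit.
Unset Printing Implicit Defensive.

Section Intervals.
Variable T : finType.
Implicit Types (b d : T -> nat) (x y : T).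

(** Helly's theorem on a line: the largest left end is a common point. *)
Lemma interval_Helly b d (P : {pred T}) :
    {in P &, forall x y, b x <= d y} ->
  exists q, {in P, forall x, b x <= q <= d x}.
Proof.
move=> bd; exists (\max_(x in P) b x) => x Px.
rewrite (leq_bigmax_cond (P := mem P) x Px) /=.
by apply/bigmax_leqP => y Py; apply: bd.
Qed.

(** The point [p] is the first one such that the intervals ending by [p] include
    two, [a] and [c], that are disjoint in the second model.  Intervals that end
    before [p] meet pairwise in the second model because [p] is first; those
    that begin after [p] miss [a] and [c] in the first model, so in the second
    one they contain the gap between [a] and [c]; and an interval of one kind
    misses those of the other kind in the first model, so it meets them in the
    second.  Hence the elements missed by [p] have second intervals that meet
    pairwise, and Helly's theorem gives [q]. *)
Lemma cross_stabbing b d b' d' :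
    (forall x y, (b x <= d y) && (b y <= d x)
              || (b' x <= d' y) && (b' y <= d' x)) ->
  exists p q, forall x, (b x <= p <= d x) || (b' x <= q <= d' x).
Proof.
move=> meet.
suff [p pP]: exists p, {in [pred x | ~~ (b x <= p <= d x)] &,
                          forall x y, b' x <= d' y}.
  have [q qP] := interval_Helly pP; exists p, q => x.
  by case: (boolP (b x <= p <= d x)) => //= /qP.
pose split_by p := [exists a, exists c, [&& d a <= p, d c <= p & d' a < b' c]].
case: (boolP [exists a, exists c, d' a < b' c]) => [|no_gap]; last first.
  (* All intervals of the second model meet, so [q] can stab them all. *)
  exists 0 => x y _ _; rewrite leqNgt; apply: contra no_gap => gap.
  by apply/existsP; exists y; apply/existsP; exists x.
move=> /existsP[a /existsP[c gap]].
have ex_split: exists p, split_by p.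
  exists (maxn (d a) (d c)); apply/existsP; exists a; apply/existsP; exists c.
  by rewrite leq_maxl leq_maxr.
case: (ex_minnP ex_split) => p /existsP[{gap}a /existsP[{}c /and3P[ap cp gap]]].
move=> p_min; exists p => x y; rewrite !inE => xp yp.
rewrite leqNgt; apply/negP => gap_yx.
have := meet x y; have := meet x a; have := meet y c.
have [dp|] : d y < p /\ d x < p \/ ~ (d y < p /\ d x < p) by lia.
  have: split_by p.-1.
    by apply/existsP; exists y; apply/existsP; exists x; apply/and3P; split; lia.
  by move=> /p_min; lia.
by lia.
Qed.

(** Times other than [p] inject into the intervals that miss [p]: a time [t > p]
    is the left end of such an interval, a time [t < p] the right end of one,
    and no interval serves for both. *)
Lemma leq_card_missed b d l p :
    (forall x, b x <= d x) ->
    (forall t, 0 < t <= l -> exists x, b x = t) ->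
    (forall t, 0 < t <= l -> exists x, d x = t) ->
  l.-1 <= #|[pred x | ~~ (b x <= p <= d x)]|.
Proof.
move=> bd left_end right_end; set M := [pred x | _].
pose end_of x := if p < b x then b x else d x.
rewrite -(size_image end_of M); apply: (@leq_trans (size (rem p (iota 1 l)))).
  case: (boolP (p \in iota 1 l)) => [/size_rem ->|/rem_id ->]; rewrite size_iota //.
  exact: leq_pred.
apply: uniq_leq_size; first exact/rem_uniq/iota_uniq.
move=> t; rewrite mem_rem_uniq ?iota_uniq // inE mem_iota => /andP[/= tp tl].
have {}tl : 0 < t <= l by lia.
case: (ltngtP p t) => [lt_pt|lt_tp|]; last by lia.
- have [x bx] := left_end t tl; apply/imageP; exists x; last first.
    by rewrite /end_of bx lt_pt.
  by rewrite inE; lia.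
- have [x dx] := right_end t tl; have := bd x => bdx.
  apply/imageP; exists x; first by rewrite inE; lia.
  by rewrite /end_of ifN //; lia.
Qed.

End Intervals.

Section Propagation.
Variables (G : sgraph) (S : {set G}).

Lemma pd_iter_mono s t : s <= t -> pd_iter S s \subset pd_iter S t.
Proof.
move=> /subnK <-; elim: (t - s) => // k IH.
exact: subset_trans IH (pd_iter_sub _ _).
Qed.

Lemma pd_iter_stuck t k :
  pd_iter S t.+1 = pd_iter S t -> pd_iter S (k + t) = pd_iter S t.
Proof.
move=> St; suff: pd_iter S (k + t) = pd_iter S t
              /\ pd_iter S (k + t).+1 = pd_iter S t by case.
by elim: k => // k [IH1 IH2]; split=> //; rewrite addSn (pd_iter_stable (t := k + t)) IH2.
Qed.

(** The vertex responsible for a new observation at step [t.+1]: an element of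
    [S] in the first step and a forcing vertex later on.  In both cases its
    closed neighborhood is then observed. *)
Lemma pd_iter_saturated t y : y \in pd_iter S t.+1 -> y \notin pd_iter S t ->
  exists2 v, adj v y & {in [pred z | (z == v) || adj v z],
                           forall z, z \in pd_iter S t.+1}.
Proof.
case: t => [|t] /=; rewrite inE => + yS; rewrite (negPf yS) /=.
  move=> /bigcupP[v vS]; rewrite inE => vy; exists v => // z.
  rewrite !inE => /orP[/eqP-> | vz]; first by rewrite vS.
  by apply/orP; right; apply/bigcupP; exists v; rewrite ?inE.
rewrite inE => /exists_inP[v vS /eqP vy]; exists v.
  by have := set11 y; rewrite -vy !inE => /andP[].
move=> z /orP[/eqP-> | vz]; rewrite inE; first by rewrite vS.
case: (boolP (z \in _)) => //= zS; rewrite inE; apply/exists_inP; exists v => //.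
by move/setP/(_ z): (vy); rewrite !inE zS vz => /esym/eqP ->; apply/eqP.
Qed.

Lemma propagation_intervals : power_dominating S ->
  exists b d : G -> nat,
    [/\ forall x, b x <= d x,
        forall x y, adj x y -> b y <= d x,
        forall t, 0 < t <= ppt_set S -> exists x, b x = t
      & forall t, 0 < t <= ppt_set S -> exists x, d x = t].
Proof.
move=> /ppt_setP[]; set l := ppt_set S => Sl l_min.
have /fin_all_exists [b bP] : forall x, exists k,
    forall t, (x \in pd_iter S t) = (k <= t).
  move=> x; have ex_t : exists t, x \in pd_iter S t by exists l; rewrite Sl inE.
  case: (ex_minnP ex_t) => k xk k_min; exists k => t.
  apply/idP/idP => [|kt]; first exact: k_min.
  exact: subsetP (pd_iter_mono kt) x xk.
have new t : 0 < t <= l -> exists x, b x = t.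
  case: t => // t /= lt_tl.
  case: (boolP [exists x, b x == t.+1]) => [/existsP[x /eqP]|no_x]; first by exists x.
  have St : pd_iter S t.+1 = pd_iter S t.
    apply/setP => x; rewrite !bP leq_eqVlt ltnS orbC.
    by case: leqP => //= _; apply: contraNF no_x => bx; apply/existsP; exists x.
  have := pd_iter_stuck (l - t) St; rewrite subnK 1?ltnW // Sl => /esym/l_min.
  by rewrite leqNgt lt_tl.
pose d x := \max_(z | (z == x) || adj x z) b z.
have bd x y : (y == x) || adj x y -> b y <= d x.
  exact: (leq_bigmax_cond (P := fun z => (z == x) || adj x z)).
exists b, d; split=> [x|x y xy|//|[|t] // /new [y yt]].
- by apply: bd; rewrite eqxx.
- by apply: bd; rewrite xy orbT.
have [||v vy vP] := @pd_iter_saturated t y; rewrite ?bP ?yt ?ltnn //.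
exists v; apply/eqP; rewrite eqn_leq -{2}yt bd ?vy ?orbT // andbT.
by apply/bigmax_leqP => z /vP; rewrite bP.
Qed.

End Propagation.

Theorem proposition8 (G : sgraph) (n : nat) (hn : #|G| = n) :
  ppt G + ppt (compl G) <= n + 2.
Proof.
have [[S /andP[pdS _] <-] _] := pptP G.
have [[S' /andP[pdS' _] <-] _] := pptP (compl G).
have [b [d [bd adj_bd b_end d_end]]] := propagation_intervals pdS.
have [b' [d' [bd' adj_bd' b'_end d'_end]]] := propagation_intervals pdS'.
have [x y|p [q pq]] := @cross_stabbing G b d b' d'.
  have [->|xy] := eqVneq x y; first by rewrite !bd.
  case: (boolP (adj x y)) => Gxy.
    by rewrite !adj_bd // adj_sym.
  have Cxy : @adj (compl G) x y by rewrite /= /compl_adj xy.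
  by apply/orP; right; rewrite !adj_bd' // adj_sym.
have missed := leq_card_missed p bd b_end d_end.
have missed' := leq_card_missed q bd' b'_end d'_end.
suff : #|[pred x | ~~ (b x <= p <= d x)]|
     + #|[pred x : compl G | ~~ (b' x <= q <= d' x)]| <= n by lia.
rewrite -hn -(cardC [pred x | ~~ (b x <= p <= d x)]) leq_add2l.
apply/subset_leq_card/subsetP => x; rewrite !inE negbK => xq.
by have := pq x; rewrite (negPf xq) orbF.
Qed.
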